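(* Let $q$ be a prime power, let $e_1\ge e_2\ge 1$ be integers and put $d=e_1+e_2$. The distinct eigenvalues of (the adjacency matrix of) the bipartite graph $\Gamma_{e_1,e_2}$ are $$\lambda_0>\cdots>\lambda_{e_2}>-\lambda_{e_2}>\cdots>-\lambda_0,$$ where $\lambda_j=q^{m_j}$ for $0\le j\le e_2$ and $m_j=e_1e_2-\frac{j(d+1-j)}{2}$.
   Context: Let $V=(\mathbb F_q)^d$ with $d=e_1+e_2$, and for $i\in\{1,2\}$ let $X_i$ be the set of $e_i$-dimensional subspaces of $V$. The graph $\Gamma_{e_1,e_2}$ is the bipartite graph whose vertex set is the disjoint union of $X_1$ and $X_2$ (two disjoint copies of the set of $e_1$-dimensional subspaces are taken if $e_1=e_2$), in which $S_1\in X_1$ and $S_2\in X_2$ are adjacent if and only if $S_1\cap S_2=\{0\}$; there are no other edges. *)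

(* Defs.v *)
From HB Require Import structures.
From mathcomp Require Import all_boot all_order all_algebra.
From mathcomp Require Import reals exp.
From mathcomp Require Import complex.
Set Implicit Arguments.
Unset Strict Implicit.
Unset Printing Implicit Defensive.

Import Order.TTheory GRing.Theory Num.Theory.
Local Open Scope ring_scope.

(* [{vspace vT}] is only a choiceType in the library; over a finite field it is
   finite, being encoded by matrices. *)
HB.instance Definition _ (F : finFieldType) (vT : vectType F) :=
  Choice_isCountable.Build {vspace vT}
    (pcan_pickleK (can_pcan (@VectorInternalTheory.vs2mxK F vT))).
HB.instance Definition _ (F : finFieldType) (vT : vectType F) :=
  isFinite.Build {vspace vT}
    (pcan_enumP (can_pcan (@VectorInternalTheory.vs2mxK F vT))).

Definition dim_subspace (F : finFieldType) (d e : nat) : finType :=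
  {U : {vspace 'rV[F]_d} | \dim U == e}.

(* The sum type keeps the two copies of the [e1]-subspaces apart if [e1 = e2]. *)
Definition gamma_vertex (F : finFieldType) (e1 e2 : nat) : finType :=
  (dim_subspace F (e1 + e2) e1 + dim_subspace F (e1 + e2) e2)%type.

Definition gamma_adj (F : finFieldType) (e1 e2 : nat) :
    rel (gamma_vertex F e1 e2) :=
  fun x y => match x, y with
  | inl S1, inr S2 | inr S2, inl S1 => (val S1 :&: val S2)%VS == 0%VS
  | _, _ => false
  end.

Definition adjacency_matrix (K : nzRingType) (T : finType) (e : rel T) :
    'M[K]_#|T| :=
  \matrix_(i, j) (e (enum_val i) (enum_val j))%:R.

Section Eigenvalues.
Variables (R : realType) (q e1 e2 : nat).

Definition gamma_exponent (j : nat) : R :=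
  e1%:R * e2%:R - j%:R * ((e1 + e2)%:R + 1 - j%:R) / 2.

Definition gamma_lambda (j : nat) : R := q%:R `^ gamma_exponent j.

(* lambda_0, ..., lambda_e2, - lambda_e2, ..., - lambda_0 *)
Definition gamma_eigenvalues : seq R :=
  [seq gamma_lambda j | j <- iota 0 e2.+1] ++
  [seq - gamma_lambda j | j <- rev (iota 0 e2.+1)].

End Eigenvalues.

(* Main.v *)
From HB Require Import structures.
Require Import Defs.
From mathcomp Require Import all_boot all_order all_algebra.
From mathcomp Require Import finfield.
From mathcomp Require Import reals exp.
From mathcomp Require Import complex.
From mathcomp Require Import ring zify.
Set Implicit Arguments.
Unset Strict Implicit.
Unset Printing Implicit Defensive.
Import Order.TTheory GRing.Theory Num.Theory.
Local Open Scope ring_scope.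

(** Write [L_e] for the functions on the [e]-dimensional subspaces of [F^d],
    [chi U] for the function [S |-> [U <= S]] and [psi U] for
    [S |-> [U :&: S = 0]].  The adjacency matrix of the graph consists of an
    operator [N : L_e1 -> L_e2], which sums a function over the complements of a
    subspace, and of its transpose [N'].

    Two facts make [N] and [N'] triangular with respect to the filtrations
    [level e i], spanned by the [chi U] with [\dim U < i]:
    - [N (chi U)] is a power of [q] times [psi U], because a subspace [U] disjoint
      from [T] lies in a number of complements of [T] that depends on [\dim U]
      only ([card_complements_above], [opposition_chi]);
    - [psi U] is [(-1)^i q^'C(i, 2) chi U] up to a combination of [chi W] with
      [\dim W < i], where [i = \dim U] ([psi_lead]).
    Hence [N N'], an endomorphism of [L_e2], acts on the quotient
    [level e2 i.+1 / level e2 i] as a scalar, and this scalar is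
    [q ^ (2 e1 e2 - i (d + 1 - i)) = lambda_i ^ 2] ([gram_triangular]).  Since
    [level e2 e2.+1] is everything, each eigenvalue of [N N'] is some
    [lambda_i ^ 2].

    For [i <= e2] the value [lambda_i ^ 2] does occur as soon as
    [level e2 i != level e2 i.+1].  Multiplying by [chi] of a line shows that one
    equality [level e2 i = level e2 i.+1] propagates upwards, so that
    [level e2 e2] would be everything ([level_collapse]).  A linear functional
    refutes this: weights depending only on [\dim (S :&: S0)] for a fixed [S0]
    can be chosen so that the functional kills all [chi W] with [\dim W < e2] but
    not [chi S0] ([chi_top_notin_level]); [2 e2 <= d] enters there.

    Finally [z] is an eigenvalue of the bipartite graph iff [z ^ 2] is an
    eigenvalue of [N N'].  A kernel of [N] could only add the eigenvalue [0];
    there is none, since [N N'] is invertible and both sides of this regular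
    bipartite graph have the same size ([opposition_inj]). *)

(** * Endomorphisms that are triangular along a filtration *)

Section TriangularEndomorphism.

Variables (K : fieldType) (vT : vectType K) (M : 'End(vT)).
Variables (n : nat) (V : nat -> {vspace vT}) (theta : nat -> K).
Hypothesis V0 : V 0 = 0%VS.
Hypothesis V_succ : forall i, (V i <= V i.+1)%VS.
Hypothesis V_tri : forall i v, (i < n)%N -> v \in V i.+1 ->
  M v - theta i *: v \in V i.

(** An eigenvector that lies in [V i.+1] but not in [V i] has a nonzero class in the
    quotient, on which [M] acts as [theta i]. *)
Lemma triangular_eigenvalue_only (v : vT) (mu : K) :
  V n = fullv -> v != 0 -> M v = mu *: v -> exists2 i, (i < n)%N & mu = theta i.
Proof.
move=> Vn v0 Mv.
have in_level k : (k <= n)%N -> v \in V k -> exists2 i, (i < n)%N & mu = theta i.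
  elim: k => [|k IH] lekn vk; first by rewrite V0 memv0 (negPf v0) in vk.
  have := V_tri lekn vk; rewrite Mv -scalerBl.
  case: (eqVneq mu (theta k)) => [-> _|ne]; first by exists k.
  rewrite rpredZeq subr_eq0 (negPf ne) /=; apply: IH; exact: ltnW.
by apply: in_level (leqnn n) _; rewrite Vn memvf.
Qed.

(** Where the filtration grows, [M - theta i] maps [V i.+1] into a space of smaller
    dimension, hence has a kernel. *)
Lemma triangular_eigenvalue_exists (i : nat) :
  (i < n)%N -> ~~ (V i.+1 <= V i)%VS -> exists2 v, v != 0 & M v = theta i *: v.
Proof.
move=> ltin nV; pose f := (M - theta i *: \1)%VF.
have fE v : f v = M v - theta i *: v.
  by rewrite add_lfunE opp_lfunE scale_lfunE id_lfunE.
have imf : (f @: V i.+1 <= V i)%VS.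
  by apply/subvP => _ /memv_imgP[v vV ->]; rewrite fE V_tri.
have ltd : (\dim (V i) < \dim (V i.+1))%N.
  rewrite ltn_neqAle dimvS // andbT; apply: contra nV => /eqP eqd.
  by have := eqEdim (V i) (V i.+1); rewrite V_succ eqd leqnn => /eqP ->.
have : (V i.+1 :&: lker f)%VS != 0%VS.
  rewrite -dimv_eq0 -lt0n; have := limg_ker_dim f (V i.+1).
  have := dimvS imf; lia.
rewrite -vpick0 => nz; exists (vpick (V i.+1 :&: lker f)%VS) => //.
have /memv_capP[_] := memv_pick (V i.+1 :&: lker f)%VS.
by rewrite memv_ker fE subr_eq0 => /eqP.
Qed.

End TriangularEndomorphism.

(** * Hyperplanes, lines and disjointness *)

Section Subspaces.

Variables (F : fieldType) (vT : vectType F).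
Implicit Types (U W S T : {vspace vT}) (x : vT).

Lemma dimv_addline U x : \dim (U + <[x]>) = (\dim U + (x \notin U))%N.
Proof.
case: (boolP (x \in U)) => [xU|nxU] /=.
  by rewrite addn0; congr (\dim _); apply/addv_idPl; rewrite -memvE.
rewrite dimv_disjoint_sum ?dim_vline; first by case: eqP nxU => [->|//]; rewrite mem0v.
apply/eqP; rewrite -subv0; apply/subvP => y /memv_capP[yU /vlineP[a ya]].
case: (eqVneq a 0) ya => [->|a0] ya; first by rewrite ya scale0r mem0v.
by case/negP: nxU; rewrite -[x](scalerK a0) -ya memvZ.
Qed.

Lemma subv_addline U x S : (U + <[x]> <= S)%VS = (U <= S)%VS && (x \in S).
Proof. by rewrite subv_add -memvE. Qed.

(** The induction step for all arguments by dimension below: a nonzero subspace is a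
    hyperplane of itself plus a line. *)
Lemma hyperplane_split U k : \dim U = k.+1 ->
  exists (H : {vspace vT}) x, [/\ x \notin H, U = (H + <[x]>)%VS & \dim H = k].
Proof.
move=> dU; have := vbasisP U; rewrite /basis_of.
case: {+}(vbasis U) (size_tuple (vbasis U)) => /= -[|x s] _; rewrite dU => // -[ss].
rewrite span_cons free_cons => /andP[/eqP <- /andP[nx frees]].
by exists <<s>>%VS, x; rewrite addvC; split=> //; rewrite (eqP frees).
Qed.

Lemma exists_subspace_dim k : (k <= \dim {:vT})%N -> exists U : {vspace vT}, \dim U = k.
Proof.
elim: k => [|k IH] lek; first by exists 0%VS; rewrite dimv0.
have [U dU] := IH (ltnW lek).
have /subvPn[x _ nx] : ~~ (fullv <= U)%VS.
  by apply/negP => /dimvS; rewrite dU leqNgt lek.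
by exists (U + <[x]>)%VS; rewrite dimv_addline dU nx addn1.
Qed.

Lemma disjoint_addline U T x : x \notin (U + T)%VS ->
  (U :&: T = 0)%VS -> ((U + <[x]>) :&: T = 0)%VS.
Proof.
move=> nx UT; apply/eqP; rewrite -dimv_eq0.
have := dimv_sum_cap (U + <[x]>) T; have := dimv_sum_cap U T.
rewrite -addvA (addvC <[x]>%VS) addvA !dimv_addline nx UT dimv0.
have -> : x \notin U by apply: contra nx; apply/subvP/addvSl.
lia.
Qed.

End Subspaces.

(** * Complements of a subspace over a finite field *)

Section Counting.

Variables (F : finFieldType) (d : nat).
Local Notation sub := {vspace 'rV[F]_d}.
Local Notation q := #|F|.
Implicit Types (U W S T : sub) (x : 'rV[F]_d).

Lemma card_subspace U : #|U| = (q ^ \dim U)%N.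
Proof. exact: card_vspace. Qed.

(** The direct sum decomposition [x = s + t] is unique, and [t] is the only element
    of [T] with [x - t \in S]. *)
Lemma complement_meets_coset S T x :
  (S :&: T = 0)%VS -> (\dim S + \dim T)%N = d ->
  #|[set t in T | x - t \in S]| = 1%N.
Proof.
move=> ST dST.
have : x \in (S + T)%VS.
  have -> : (S + T = fullv)%VS; last exact: memvf.
  apply/eqP; rewrite eqEdim subvf dimvf /dim /= mul1n.
  by rewrite dimv_disjoint_sum ?dST.
case/memv_addP => s sS [t tT xE].
transitivity #|[set t]|; last exact: cards1.
apply: eq_card => t'; rewrite !inE.
apply/andP/eqP => [[t'T xt']|->]; last by rewrite xE addrK.
apply/eqP; rewrite -subr_eq0 -memv0 -ST memv_cap; apply/andP; split; last exact: memvB.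
by rewrite -[t' - t](subKr s) memvB // opprB addrA -xE.
Qed.

(** Downward induction on [\dim U].  Fix [x] outside [U + T].  A complement [S] of
    [T] above [U] contains exactly one of the vectors [x - t], [t \in T], so these
    complements are partitioned into [q ^ e'] classes, the complements above
    [U + <[x - t]>]; and that subspace is again disjoint from [T]. *)
Lemma card_complements_above e e' U T :
  (e + e')%N = d -> \dim T = e' -> (U :&: T = 0)%VS ->
  #|[set S : dim_subspace F d e | (U <= val S)%VS && (val S :&: T == 0)%VS]|
    = (q ^ (e' * (e - \dim U)))%N.
Proof.
move=> dE dT; move n_eq: (e - \dim U)%N => n.
elim: n U n_eq => [|n IH] U n_eq UT.
  have dU : \dim U = e.
    have := dimvS (subvf (U + T)); rewrite dimv_disjoint_sum // dT.
    rewrite dimvf /dim /= mul1n; lia.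
  (* For dimension reasons U itself is the only complement above U. *)
  rewrite muln0 expn0.
  transitivity #|[set (Sub U (introT eqP dU) : dim_subspace F d e)]|;
    last exact: cards1.
  apply: eq_card => S; rewrite !inE; apply/andP/eqP => [[US _]|->]; last first.
    by rewrite subvv UT eqxx.
  apply/val_inj/esym/eqP; rewrite eqEdim US.
  by rewrite (eqP (valP S)) /= dU.
have /subvPn[x _ nx] : ~~ (fullv <= U + T)%VS.
  apply/negP => /dimvS; rewrite dimv_disjoint_sum // dT dimvf /dim /= mul1n; lia.
set A := [set S | _].
have step t : t \in T ->
    #|[set S in A | x - t \in val S]| = (q ^ (e' * n))%N.
  move=> tT; have nxt : x - t \notin (U + T)%VS.
    by rewrite rpredBr // (subvP (addvSr _ _)).
  rewrite -(IH (U + <[x - t]>)%VS); last exact: disjoint_addline.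
    by apply: eq_card => S; rewrite !inE subv_addline andbAC.
  have nxU : x - t \notin U by apply: contra nxt; apply/subvP/addvSl.
  by rewrite dimv_addline nxU; lia.
(* Double counting of the pairs (S, t) with x - t in S. *)
transitivity (\sum_(S in A) #|[set t in T | (x - t)%R \in val S]|)%N.
  rewrite -sum1_card; apply: eq_bigr => S; rewrite inE => /andP[_ /eqP ST].
  by rewrite complement_meets_coset // dT (eqP (valP S)).
transitivity (\sum_(t in T) #|[set S in A | (x - t)%R \in val S]|)%N.
  under eq_bigr do rewrite -sum1dep_card.
  under [RHS]eq_bigr do rewrite -sum1dep_card.
  rewrite (exchange_big_dep (mem T)) /=; last by move=> S t _ /andP[].
  by apply: eq_bigr => t tT; apply: eq_bigl => S; rewrite tT.
rewrite (eq_bigr _ step) sum_nat_const card_subspace dT -expnD; congr (_ ^ _)%N.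
by rewrite mulnS.
Qed.

End Counting.

(** * The filtration of functions on subspaces *)

Section Levels.

Variables (K : numFieldType) (F : finFieldType) (d : nat).
Local Notation sub := {vspace 'rV[F]_d}.
Local Notation q := #|F|.
Local Notation "'L_ e" := {ffun dim_subspace F d e -> K^o} (at level 8, e at level 2).
Implicit Types (U W H : sub) (x : 'rV[F]_d).

Definition chi e U : 'L_e := [ffun S => (U <= val S)%VS%:R].
Definition psi e U : 'L_e := [ffun S => (U :&: val S == 0)%VS%:R].

(** The bound on [\dim U] is strict, so that the filtration starts with the zero
    space, as [triangular_eigenvalue_only] requires. *)
Definition level e i : {vspace 'L_e} :=
  <<[seq chi e U | U in [pred W : sub | (\dim W < i)%N]]>>%VS.

Lemma chi_in_level e i U : (\dim U < i)%N -> chi e U \in level e i.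
Proof. by move=> ltU; apply/memv_span/image_f. Qed.

Lemma level_sub e i (A : {vspace 'L_e}) :
  (forall U, (\dim U < i)%N -> chi e U \in A) -> (level e i <= A)%VS.
Proof.
by move=> sA; apply/span_subvP => _ /imageP[U /sA ? ->].
Qed.

Lemma limg_level e e' i (f : 'Hom('L_e, 'L_e')) (A : {vspace 'L_e'}) :
  (forall U, (\dim U < i)%N -> f (chi e U) \in A) ->
  forall g, g \in level e i -> f g \in A.
Proof.
move=> fA g gi; have : f g \in (f @: level e i)%VS by apply: memv_img.
apply: subvP; rewrite limg_span; apply/span_subvP => _ /mapP[_ /imageP[U /fA ? ->] ->].
by [].
Qed.

Lemma level0 e : level e 0 = 0%VS.
Proof. by apply/eqP; rewrite -subv0; apply: level_sub. Qed.

Lemma level_mono e i j : (i <= j)%N -> (level e i <= level e j)%VS.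
Proof. by move=> leij; apply: level_sub => U ltU; apply/chi_in_level/(leq_trans ltU). Qed.

(** The functions [chi U] with [\dim U = e] are the indicators of the points. *)
Lemma level_full e : level e e.+1 = fullv.
Proof.
apply/eqP; rewrite eqEsubv subvf; apply/subvP => f _.
have -> : f = \sum_S f S *: chi e (val S).
  apply/ffunP => T; rewrite sum_ffunE (bigD1 T) //= !ffunE subvv.
  rewrite big1 ?addr0 => [|S nST]; first by rewrite [RHS]mulr1.
  rewrite !ffunE; have [ST|] := boolP (val S <= val T)%VS; last by rewrite scaler0.
  case/eqP: nST; apply/val_inj/eqP; rewrite eqEdim ST.
  by rewrite (eqP (valP S)) (eqP (valP T)) /=.
apply: memv_suml => S _; apply/memvZ/chi_in_level.
by rewrite (eqP (valP S)).
Qed.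

(** Pointwise multiplication by [chi] of the line spanned by [x]. *)
Definition restrict_fun e x (f : 'L_e) : 'L_e :=
  [ffun S : dim_subspace F d e => (x \in val S)%:R * f S].
Fact restrict_fun_linear e x : linear (@restrict_fun e x).
Proof.
by move=> a f g; apply/ffunP => S; rewrite !ffunE mulrDr; congr (_ + _); apply: mulrCA.
Qed.
HB.instance Definition _ e x :=
  GRing.isLinear.Build K 'L_e 'L_e _ _ (@restrict_fun_linear e x).
Definition restrict e x : 'End('L_e) := linfun (@restrict_fun e x).

Lemma restrictE e x f S : restrict e x f S = (x \in val S)%:R * f S.
Proof. by rewrite lfunE ffunE. Qed.

Lemma restrict_chi e x U : restrict e x (chi e U) = chi e (U + <[x]>)%VS.
Proof. by apply/ffunP => S; rewrite restrictE !ffunE subv_addline -natrM mulnb andbC. Qed.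

Lemma restrict_level e x i f :
  f \in level e i -> restrict e x f \in level e i.+1.
Proof.
apply: limg_level => U ltU; rewrite restrict_chi; apply: chi_in_level.
by rewrite dimv_addline; case: (_ \notin _); rewrite ?addn1 ?addn0 // ltnS ltnW.
Qed.

(** For [S] disjoint from [H], the sum counts the vectors of [S] in the coset
    [x + H].  There is at most one, since the difference of two lies in [S :&: H],
    and there is one iff [S] meets [H + <[x]>], since a nonzero vector of this
    intersection can be scaled into the coset. *)
Lemma psi_addline e H x : x \notin H ->
  psi e (H + <[x]>)%VS = psi e H - \sum_(h in H) restrict e (x + h) (psi e H).
Proof.
move=> nx; apply/ffunP => S.
rewrite !ffunE sum_ffunE; under eq_bigr do rewrite restrictE ffunE.
rewrite -mulr_suml -[X in X - _]mul1r -mulrBl.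
case: (eqVneq (H :&: val S)%VS 0%VS) => [HS|nHS]; last first.
  rewrite mulr0 (negPf (_ : _ != 0%VS)) //; apply: contra nHS => /eqP HxS.
  by rewrite -subv0 -HxS capvS // addvSl.
rewrite mulr1; case: eqP => [HxS|/eqP nHxS].
  rewrite big1 ?subr0 // => h hH; apply/eqP; rewrite pnatr_eq0 eqb0.
  apply: contra nx => xhS.
  have : x + h \in ((H + <[x]>) :&: val S)%VS.
    by rewrite memv_cap xhS andbT addrC memv_add ?memv_line.
  by rewrite HxS memv0 addr_eq0 => /eqP ->; rewrite memvN.
have : vpick ((H + <[x]>) :&: val S)%VS != 0 by rewrite vpick0.
have := memv_pick ((H + <[x]>) :&: val S)%VS.
move: (vpick _) => y /memv_capP[/memv_addP[h hH [_ /vlineP[a ->] yE]] yS] y0.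
have a0 : a != 0.
  apply: contraNneq y0 => a0; move: yS; rewrite yE a0 scale0r addr0 => hS.
  by rewrite -memv0 -HS memv_cap hH.
have xhS : x + a^-1 *: h \in val S.
  by rewrite -[x](scalerK a0) -scalerDr addrC -yE memvZ.
rewrite (bigD1 (a^-1 *: h)) ?memvZ //= xhS big1 ?addr0 ?subrr // => h' /andP[h'H ne].
apply/eqP; rewrite pnatr_eq0 eqb0; apply: contra ne => xh'S.
rewrite -subr_eq0 -memv0 -HS memv_cap memvB ?memvZ //=.
by rewrite -(addrKA x) [h' + x]addrC memvB.
Qed.

(** The Moebius function of the lattice of subspaces of [F^i]: the coefficient of
    [chi U] in [psi U] when [\dim U = i]. *)
Definition lead i : K := (-1) ^+ i * (q ^ 'C(i, 2))%:R.

(** Induction on the dimension through [psi_addline]: each of the [q ^ \dim H] terms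
    of the sum turns the leading term [chi H] into [chi (H + <[x + h]>)], which is
    [chi U], and raises the dimensions in the other terms by at most one. *)
Lemma psi_lead e U : psi e U - lead (\dim U) *: chi e U \in level e (\dim U).
Proof.
move i_eq: (\dim U) => i; elim: i U i_eq => [|i IH] U dU.
  have -> : U = 0%VS by apply/eqP; rewrite -dimv_eq0 dU.
  rewrite level0 memv0; apply/eqP/ffunP => S; rewrite !ffunE cap0v eqxx sub0v.
  by rewrite /lead expr0 bin0n expn0 [_ *: _]mulr1 mulr1 subrr.
have [H [x [nx UE dH]]] := hyperplane_split dU.
have lH := IH H dH; set r := psi e H - _ in lH.
have psiH : psi e H = lead i *: chi e H + r by rewrite addrC /r subrK.
have restrict_psi h : h \in H ->
    restrict e (x + h) (psi e H) = lead i *: chi e U + restrict e (x + h) r.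
  move=> hH; rewrite psiH linearD linearZ /= restrict_chi UE.
  congr (_ *: chi e _ + _); apply/eqP; rewrite eqEsubv !subv_addline !addvSl /=.
  rewrite (addrC x) memv_add ?memv_line //=.
  by rewrite -[X in X \in _](addKr h) memv_add ?memv_line ?memvN.
rewrite UE (psi_addline _ nx) -UE (eq_bigr _ restrict_psi) big_split /= sumr_const.
rewrite card_subspace dH.
have -> : lead i *: chi e U *+ q ^ i = - (lead i.+1 *: chi e U).
  rewrite -scaler_nat scalerA -scaleNr; congr (_ *: _).
  by rewrite /lead exprS binS bin1 expnD natrM; ring.
rewrite opprD opprK addrA addrAC addrK.
apply: memvB; last by apply: memv_suml => h hH; apply: restrict_level.
rewrite psiH; apply: memvD; first by apply/memvZ/chi_in_level; rewrite dH.
exact: (subvP (level_mono _ (leqnSn i))).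
Qed.

Lemma psi_in_level e i U : (\dim U < i)%N -> psi e U \in level e i.
Proof.
move=> ltU; rewrite -[psi e U](subrK (lead (\dim U) *: chi e U)).
apply: memvD; last by apply/memvZ/chi_in_level.
exact: (subvP (level_mono _ (ltnW ltU)) _ (psi_lead e U)).
Qed.

End Levels.

(** * Strictness of the filtration *)

Section Nondegeneracy.

Variables (K : numFieldType) (F : finFieldType) (d e : nat).
Hypothesis le_e : (e.+1 + e.+1 <= d)%N.
Local Notation sub := {vspace 'rV[F]_d}.
Local Notation X := (dim_subspace F d e.+1).
Local Notation q := #|F|.
Implicit Types (U W T : sub) (x : 'rV[F]_d) (S : X).

Lemma q_powB_neq0 m n : (m < n)%N -> (q ^ n)%:R - (q ^ m)%:R != 0 :> K.
Proof.
move=> ltmn; rewrite subr_eq0 eqr_nat neq_ltn; apply/orP; right.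
by rewrite ltn_exp2l // finNzRing_gt1.
Qed.

Lemma sum_outside W T (c : K) : (W <= T)%VS ->
  \sum_(x in T | x \notin W) c = ((q ^ \dim T)%:R - (q ^ \dim W)%:R) * c.
Proof.
move=> WT; rewrite -!card_subspace -!sumr_const mulrBl !mulr_suml.
apply/eqP; rewrite eq_sym subr_eq mul1r; apply/eqP.
rewrite (bigID (fun x => x \in W)) /= addrC; congr (_ + _).
by apply: eq_bigl => x; case: (boolP (x \in W)) => [/(subvP WT) ->|]; rewrite ?andbF.
Qed.

(** Double counting: a subspace [S] above [W] arises from each of its vectors
    outside [W]. *)
Lemma sum_over_lines (w : X -> K) W :
  \sum_(x | x \notin W) \sum_(S | (W + <[x]> <= val S)%VS) w S =
  ((q ^ e.+1)%:R - (q ^ \dim W)%:R) * \sum_(S | (W <= val S)%VS) w S.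
Proof.
rewrite (exchange_big_dep (fun S => (W <= val S)%VS)) /=; last first.
  by move=> x S _; rewrite subv_addline => /andP[].
rewrite mulr_sumr; apply: eq_bigr => S WS.
rewrite -{2}(eqP (valP S)) -sum_outside //; apply: eq_bigl => x.
by rewrite subv_addline WS andbC.
Qed.

(** The weight of a subspace [S] with [\dim (S :&: S0) = k].  The factors are the
    ratios that make the weights of the [e.+1]-subspaces above a given
    [e]-subspace cancel, see [zonal_rec]. *)
Definition zonal k : K := \prod_(l < k)
  (((q ^ (e + e.+1 - l))%:R - (q ^ d)%:R) / ((q ^ (e + e.+1 - l))%:R - (q ^ e)%:R)).

(** The numerators do not vanish because [e + e.+1 - l < d]. *)
Lemma zonal_neq0 : zonal e.+1 != 0.
Proof.
apply/prodf_neq0 => l _; rewrite mulf_neq0 ?invr_neq0 //.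
  by rewrite -opprB oppr_eq0 q_powB_neq0 //; lia.
by rewrite q_powB_neq0 //; have := ltn_ord l; lia.
Qed.

(** If [\dim W = e] and [\dim (W :&: S0) = j], the first coefficient counts the
    vectors [x] of [W + S0] outside [W], for which [W + <[x]>] meets [S0] in
    dimension [j.+1], and the second one counts the vectors outside [W + S0], for
    which the dimension stays [j]. *)
Lemma zonal_rec j : (j <= e)%N ->
  zonal j.+1 * ((q ^ (e + e.+1 - j))%:R - (q ^ e)%:R)
  + zonal j * ((q ^ d)%:R - (q ^ (e + e.+1 - j))%:R) = 0.
Proof.
move=> lej; rewrite /zonal big_ord_recr /= mulrA divfK; first by ring.
by rewrite q_powB_neq0 //; lia.
Qed.

Variable S0 : X.
Let weight S := zonal (\dim (val S :&: val S0)).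

(** Downward induction on [\dim W]: by [sum_over_lines] a nonzero multiple of the sum
    above [W] is the total of the sums above the subspaces [W + <[x]>].  These
    vanish by induction, except for [\dim W = e], where the total is that of
    [zonal_rec]. *)
Lemma sum_weight_above W : (\dim W <= e)%N -> \sum_(S | (W <= val S)%VS) weight S = 0.
Proof.
move: {2}(e - _)%N (erefl (e - \dim W)%N) => n; elim: n W => [|n IH] W n_eq leW.
all: apply: (mulfI (@q_powB_neq0 (\dim W) e.+1 _)); rewrite ?mulr0 ?ltnS //.
all: rewrite -sum_over_lines.
  have dW : \dim W = e by lia.
  pose j := \dim (W :&: val S0); have dS0 := eqP (valP S0).
  have dWS0 : \dim (W + val S0) = (e + e.+1 - j)%N.
    have := dimv_sum_cap W (val S0); rewrite dS0 dW /j; lia.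
  have lej : (j <= e)%N by rewrite -dW dimvS ?capvSl.
  have term x : x \notin W ->
      \sum_(S | (W + <[x]> <= val S)%VS) weight S
        = if x \in (W + val S0)%VS then zonal j.+1 else zonal j.
    move=> nx; have dWx : \dim (W + <[x]>) == e.+1 by rewrite dimv_addline nx dW addn1.
    rewrite (big_pred1 (Sub (W + <[x]>)%VS dWx : X)) /= => [|S]; last first.
      apply/idP/eqP => [WxS|-> //]; apply/val_inj/esym/eqP.
      by rewrite eqEdim WxS (eqP (valP S)) /= (eqP dWx).
    rewrite /weight /=.
    have := dimv_sum_cap (W + <[x]>) (val S0).
    rewrite -addvA (addvC <[x]>%VS) addvA (eqP dWx) dimv_addline dWS0 dS0.
    case: (x \in _) => /= dcap; congr (zonal _); lia.
  rewrite (eq_bigr _ term) (bigID (fun x => x \in (W + val S0)%VS)) /=.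
  rewrite (eq_bigr (fun=> zonal j.+1)) => [|x /andP[_ ->] //].
  rewrite [X in _ + X](eq_bigr (fun=> zonal j)) => [|x /andP[_ /negPf ->] //].
  rewrite -[RHS](zonal_rec lej); congr (_ + _).
    rewrite mulrC -dWS0 -[X in _ - (q ^ X)%:R]dW -sum_outside ?addvSl //.
    by apply: eq_bigl => x; apply: andbC.
  have dfull : \dim {: 'rV[F]_d} = d by rewrite dimvf /dim /= mul1n.
  rewrite mulrC -dWS0 -[X in (q ^ X)%:R - _]dfull -sum_outside ?subvf //.
  apply: eq_bigl => x; rewrite memvf /=.
  by apply: andb_idl; apply: contra; apply/subvP/addvSl.
rewrite big1 // => x nx; apply: IH; rewrite dimv_addline nx; lia.
Qed.

Definition weighted_sum_fun (f : {ffun X -> K^o}) : K^o := \sum_S weight S * f S.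
Fact weighted_sum_fun_linear : linear weighted_sum_fun.
Proof.
move=> a f g.
transitivity (a * (\sum_S weight S * f S) + \sum_S weight S * g S); last by [].
rewrite mulr_sumr -big_split.
by apply: eq_bigr => S _ /=; rewrite !ffunE mulrDr; congr (_ + _); apply: mulrCA.
Qed.
HB.instance Definition _ :=
  GRing.isLinear.Build K {ffun X -> K^o} K^o _ _ weighted_sum_fun_linear.

(** The functional with the weights [zonal] vanishes on the level but takes the
    value [zonal e.+1] at [chi S0]. *)
Lemma chi_top_notin_level : chi K e.+1 (val S0) \notin level K F d e.+1 e.+1.
Proof.
pose phi := linfun weighted_sum_fun.
have phi_chi U : phi (chi K e.+1 U) = \sum_(S | (U <= val S)%VS) weight S.
  rewrite lfunE [RHS]big_mkcond; apply: eq_bigr => S _ /=.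
  by rewrite ffunE; case: (_ <= _)%VS; rewrite ?mulr1 ?mulr0.
apply/negP => chi_in; have : phi (chi K e.+1 (val S0)) = 0.
  apply/eqP; rewrite -memv_ker; apply: subvP chi_in; apply: level_sub => U ltU.
  by rewrite memv_ker phi_chi sum_weight_above.
rewrite phi_chi (big_pred1 S0) => [|S]; last first.
  apply/idP/eqP => [S0S|-> //]; apply/val_inj/esym/eqP.
  by rewrite eqEdim S0S (eqP (valP S)) (eqP (valP S0)) /=.
by apply/eqP; rewrite /weight capvv (eqP (valP S0)) zonal_neq0.
Qed.

End Nondegeneracy.

Section LevelsStrict.

Variables (K : numFieldType) (F : finFieldType) (d e : nat).
Hypothesis le_e : (e + e <= d)%N.

Lemma level_top_proper : ~~ (level K F d e e.+1 <= level K F d e e)%VS.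
Proof.
have [U /eqP dU] : exists U : {vspace 'rV[F]_d}, \dim U = e.
  by apply: exists_subspace_dim; rewrite dimvf /dim /= mul1n; lia.
move: (Sub U dU : dim_subspace F d e) => S0 {U dU}.
apply/subvPn; exists (chi K e (val S0)).
  by rewrite level_full memvf.
case: e le_e S0 => [|e'] le_e' S0; last exact: chi_top_notin_level.
rewrite level0 memv0; apply/eqP => /ffunP/(_ S0)/eqP.
by rewrite !ffunE subvv oner_eq0.
Qed.

(** If the functions [chi U] with [\dim U = i] are combinations of lower ones, then
    multiplication by [chi] of a line gives the same for dimension [i.+1], and so
    on. *)
Lemma level_collapse i j : (i <= j)%N ->
  (level K F d e i.+1 <= level K F d e i)%VS ->
  (level K F d e j.+1 <= level K F d e i)%VS.
Proof.
move=> leij coll; rewrite -(subnK leij).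
elim: (j - i)%N => [//|k IH]; apply: level_sub => U.
rewrite ltnS leq_eqVlt => /orP[/eqP dU|ltU]; last first.
  by apply: (subvP IH); apply: chi_in_level.
have [H [x [nx -> dH]]] := hyperplane_split dU.
rewrite -restrict_chi; apply: (subvP coll); apply: restrict_level.
by apply: (subvP IH); apply: chi_in_level; rewrite dH.
Qed.

Lemma level_strict i : (i <= e)%N ->
  ~~ (level K F d e i.+1 <= level K F d e i)%VS.
Proof.
move=> leie; apply: contra level_top_proper => coll.
by apply: subv_trans (level_collapse leie coll) _; apply: level_mono.
Qed.

End LevelsStrict.

(** * The opposition operators *)

Section Opposition.

Variables (K : numFieldType) (F : finFieldType) (d : nat).
Local Notation sub := {vspace 'rV[F]_d}.
Local Notation q := #|F|.
Local Notation "'L_ e" := {ffun dim_subspace F d e -> K^o} (at level 8, e at level 2).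
Local Notation chi := (chi K).
Local Notation psi := (psi K).
Local Notation level := (level K F d).
Local Notation lead := (lead K F).
Implicit Types (U W : sub) (e i : nat).

Definition opposition_fun e e' (f : 'L_e) : 'L_e' :=
  [ffun T : dim_subspace F d e' =>
    \sum_(S : dim_subspace F d e | (val S :&: val T)%VS == 0%VS) f S].
Fact opposition_fun_linear e e' : linear (@opposition_fun e e').
Proof.
move=> a f g; apply/ffunP => T; rewrite !ffunE /=.
transitivity (a * (\sum_(S : dim_subspace F d e | (val S :&: val T)%VS == 0%VS) f S)
  + \sum_(S : dim_subspace F d e | (val S :&: val T)%VS == 0%VS) g S); last by [].
by rewrite mulr_sumr -big_split; apply: eq_bigr => S _; rewrite !ffunE.
Qed.
HB.instance Definition _ e e' :=
  GRing.isLinear.Build K 'L_e 'L_e' _ _ (@opposition_fun_linear e e').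
Definition opposition e e' : 'Hom('L_e, 'L_e') := linfun (@opposition_fun e e').

Lemma oppositionE e e' f T : opposition e e' f T =
  \sum_(S : dim_subspace F d e | (val S :&: val T)%VS == 0%VS) f S.
Proof. by rewrite lfunE ffunE. Qed.

Section Complementary.

Variables (e e' : nat).
Hypothesis dE : (e + e')%N = d.

(** The value at [T] counts the complements of [T] above [U]; there are none if [U]
    meets [T]. *)
Lemma opposition_chi U :
  opposition e e' (chi e U) = (q ^ (e' * (e - \dim U)))%:R *: psi e' U.
Proof.
apply/ffunP => T; rewrite oppositionE !ffunE.
under eq_bigr do rewrite ffunE.
rewrite -natr_sum -big_mkcondr sum1dep_card.
case: eqP => [UT|nUT].
  rewrite [RHS]mulr1 -(card_complements_above dE (eqP (valP T)) UT).
  by congr (_%:R); apply: eq_card => S; rewrite !inE andbC.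
rewrite scaler0 eq_card0 // => S; rewrite !inE; apply/negP => /andP[/eqP ST US].
by apply: nUT; apply/eqP; rewrite -subv0 -ST capvS.
Qed.

Definition opposition_coef i : K := (q ^ (e' * (e - i)))%:R * lead i.

Lemma opposition_lead U :
  opposition e e' (chi e U) - opposition_coef (\dim U) *: chi e' U
    \in level e' (\dim U).
Proof.
by rewrite opposition_chi /opposition_coef -scalerA -scalerBr memvZ ?psi_lead.
Qed.

Lemma opposition_level i f :
  f \in level e i -> opposition e e' f \in level e' i.
Proof.
by apply: limg_level => U ltU; rewrite opposition_chi memvZ // psi_in_level.
Qed.

End Complementary.

Section Gram.

Variables (e e' : nat).

(** The product of the off-diagonal blocks of the adjacency matrix, that is, its
    square restricted to the functions on the [e']-subspaces. *)
Definition gram : 'End('L_e') := (opposition e e' \o opposition e' e)%VF.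

Definition gram_coef i : K := opposition_coef e' e i * opposition_coef e e' i.

(** The exponent is [2 e e' - i (e + e' + 1 - i)], written without subtractions of
    products.  The signs [(-1) ^ i] of the two steps cancel. *)
Lemma gram_coefE i : (i <= e)%N -> (i <= e')%N ->
  gram_coef i = (q ^ (2 * 'C(i, 2) + e * (e' - i) + e' * (e - i)))%:R.
Proof.
move=> lei lei'; rewrite /gram_coef /opposition_coef /lead.
rewrite mulrACA [X in _ * X]mulrACA -exprMn mulrNN mulr1 expr1n mul1r -!natrM -!expnD.
by congr (_ ^ _)%:R; lia.
Qed.

Hypothesis dE : (e + e')%N = d.

Lemma gram_triangular i f : f \in level e' i.+1 ->
  gram f - gram_coef i *: f \in level e' i.
Proof.
pose g := (gram - gram_coef i *: \1)%VF.
have gE h : g h = gram h - gram_coef i *: h.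
  by rewrite add_lfunE opp_lfunE scale_lfunE id_lfunE.
have dE' : (e' + e)%N = d by rewrite addnC.
rewrite -gE; apply: limg_level => U; rewrite gE comp_lfunE ltnS leq_eqVlt.
case/orP => [/eqP dU|ltU]; last first.
  apply: memvB; last by apply/memvZ/chi_in_level.
  by apply: (opposition_level dE); apply: (opposition_level dE'); apply: chi_in_level.
have := opposition_lead dE' U; have := opposition_lead dE U; rewrite dU.
set r := _ - _ => r_in; set r' := _ - _ => r'_in.
have -> : opposition e' e (chi e' U) = opposition_coef e' e i *: chi e U + r'.
  by rewrite addrC subrK.
have o_chi : opposition e e' (chi e U) = opposition_coef e e' i *: chi e' U + r.
  by rewrite addrC subrK.
rewrite linearD linearZ /= o_chi scalerDr scalerA addrAC [X in X + _]addrAC subrr add0r.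
by apply: memvD; [apply: memvZ | apply: (opposition_level dE)].
Qed.

Lemma gram_eigenvalue_only (f : 'L_e') mu :
  f != 0 -> gram f = mu *: f -> exists2 i, (i <= e')%N & mu = gram_coef i.
Proof.
move=> f0 gf.
apply: (triangular_eigenvalue_only (V := level e')) (level_full _ _ _ _) f0 gf.
- exact: level0.
- by move=> i v _; apply: gram_triangular.
Qed.

Lemma gram_eigenvalue_exists i : (e' <= e)%N -> (i <= e')%N ->
  exists2 f : 'L_e', f != 0 & gram f = gram_coef i *: f.
Proof.
move=> lee lei; apply: (triangular_eigenvalue_exists (V := level e') (n := e'.+1)) => //.
- by move=> j; apply: level_mono.
- by move=> j v _; apply: gram_triangular.
- by apply: level_strict => //; rewrite -dE leq_add2r.
Qed.

End Gram.

(** Complementarity is a bipartite relation in which every vertex, on either side,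
    has [q ^ (e e')] neighbours. *)
Lemma card_dim_subspace_compl e e' : (e + e')%N = d ->
  #|dim_subspace F d e| = #|dim_subspace F d e'|.
Proof.
move=> dE.
have q_gt0 : (0 < q ^ (e' * e))%N by rewrite expn_gt0 (ltnW (finNzRing_gt1 F)).
apply/eqP; rewrite -(eqn_pmul2r q_gt0); apply/eqP.
transitivity (\sum_(S : dim_subspace F d e)
    #|[set T : dim_subspace F d e' | (val T :&: val S)%VS == 0%VS]|)%N.
  rewrite -sum_nat_const; apply: eq_bigr => S _.
  have dE' : (e' + e)%N = d by rewrite addnC.
  have := card_complements_above dE' (eqP (valP S)) (cap0v (val S)).
  rewrite dimv0 subn0 mulnC => <-.
  by apply: eq_card => T; rewrite !inE sub0v.
under eq_bigr do rewrite -sum1dep_card.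
rewrite (exchange_big_dep predT) //= -sum_nat_const; apply: eq_bigr => T _.
have := card_complements_above dE (eqP (valP T)) (cap0v (val T)).
rewrite dimv0 subn0 => <-; rewrite sum1dep_card.
by apply: eq_card => S; rewrite !inE sub0v capvC.
Qed.

(** The Gram endomorphism has no eigenvalue [0], so the opposition operator is onto;
    both spaces have the same dimension. *)
Lemma opposition_inj e e' f : (e + e')%N = d -> (e' <= e)%N ->
  opposition e e' f = 0 -> f = 0.
Proof.
move=> dE lee of0.
have gram_inj : lker (gram e e') == 0%VS.
  rewrite -vpick0; apply/negPn/negP => f0.
  have := memv_pick (lker (gram e e')); rewrite memv_ker => /eqP gf.
  have [|i lei] := gram_eigenvalue_only dE f0 (mu := 0); first by rewrite gf scale0r.
  rewrite gram_coefE ?(leq_trans lei) // => /eqP; rewrite eq_sym pnatr_eq0.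
  by rewrite expn_eq0 -leqn0 leqNgt (ltnW (finNzRing_gt1 F)).
have full : (limg (opposition e e') = fullv)%VS.
  apply/eqP; rewrite eqEsubv subvf -(lker0_limgf gram_inj) /gram limg_comp.
  by apply/limgS/subvf.
have := limg_ker_dim (opposition e e') fullv.
rewrite full capfv !dimvf /dim /= (card_dim_subspace_compl dE) => /eqP.
rewrite -[X in _ == X]add0n eqn_add2r dimv_eq0 => /eqP ker0.
by apply/eqP; rewrite -memv0 -ker0 memv_ker of0.
Qed.

End Opposition.

(** * The spectrum of the graph *)

Section GammaSpectrum.

Lemma adjacency_eigenvalueP (K : fieldType) (T : finType) (r : rel T) (z : K) :
  eigenvalue (adjacency_matrix K r) z <->
  exists2 f : {ffun T -> K}, f != 0 & forall y, \sum_(x | r x y) f x = z * f y.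
Proof.
split=> [/eigenvalueP[v vA v0] | [f f0 fA]].
  exists [ffun x => v 0 (enum_rank x)].
    apply: contraNneq v0 => f0; apply/eqP/rowP => i; rewrite mxE.
    by have /ffunP/(_ (enum_val i)) := f0; rewrite !ffunE enum_valK.
  move=> y; have /rowP/(_ (enum_rank y)) := vA; rewrite !mxE ffunE => <-.
  rewrite (reindex_onto enum_val enum_rank) => [|i _]; last exact: enum_rankK.
  rewrite [LHS]big_mkcond; apply: eq_bigr => i _.
  rewrite !mxE ffunE enum_valK enum_rankK eqxx andbT.
  by case: (r _ _); rewrite ?mulr1 ?mulr0.
apply/eigenvalueP; exists (\row_i f (enum_val i)).
  apply/rowP => j; rewrite !mxE -fA.
  rewrite [RHS](reindex_onto enum_val enum_rank) => [|i _]; last exact: enum_rankK.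
  rewrite [RHS]big_mkcond; apply: eq_bigr => i _.
  by rewrite !mxE enum_valK eqxx andbT; case: (r _ _); rewrite ?mulr1 ?mulr0.
apply: contraNneq f0 => v0; apply/eqP/ffunP => x; rewrite ffunE.
by have /rowP/(_ (enum_rank x)) := v0; rewrite !mxE enum_rankK.
Qed.

Variables (K : numFieldType) (F : finFieldType) (e1 e2 : nat).
Hypothesis le_e : (e2 <= e1)%N.
Local Notation q := #|F|.
Local Notation A := (adjacency_matrix K (@gamma_adj F e1 e2)).
Local Notation N := (opposition K F (e1 + e2) e1 e2).
Local Notation N' := (opposition K F (e1 + e2) e2 e1).

Lemma gamma_eigenvalue_pair z : eigenvalue A z <->
  exists f1 f2, [/\ (f1 != 0) || (f2 != 0), N f1 = z *: f2 & N' f2 = z *: f1].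
Proof.
rewrite adjacency_eigenvalueP; split=> [[f f0 fA] | [f1 [f2 [f12 Nf1 Nf2]]]].
  exists [ffun S => f (inl S)], [ffun S => f (inr S)]; split.
  - apply: contraR f0; rewrite negb_or !negbK => /andP[/eqP f1 /eqP f2].
    apply/eqP/ffunP => -[] S; rewrite [RHS]ffunE.
      by have /ffunP/(_ S) := f1; rewrite !ffunE.
    by have /ffunP/(_ S) := f2; rewrite !ffunE.
  - apply/ffunP => S; rewrite oppositionE !ffunE.
    apply: etrans (fA (inr S)); rewrite big_sumType /=.
    rewrite [X in _ + X]big_pred0 ?addr0 //.
    by apply: eq_bigr => S' _; rewrite ffunE.
  apply/ffunP => S; rewrite oppositionE !ffunE.
  apply: etrans (fA (inl S)); rewrite big_sumType /=.
  rewrite [X in X + _]big_pred0 ?add0r //.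
  by apply: eq_big => S'; rewrite ?ffunE // capvC.
exists [ffun x => match x with inl s => f1 s | inr s => f2 s end].
  apply: contraTneq f12 => f0; rewrite negb_or !negbK; apply/andP; split.
    by apply/eqP/ffunP => S; have /ffunP/(_ (inl S)) := f0; rewrite !ffunE.
  by apply/eqP/ffunP => S; have /ffunP/(_ (inr S)) := f0; rewrite !ffunE.
case=> S; rewrite big_sumType /=.
  transitivity (N' f2 S); last by rewrite Nf2 !ffunE.
  rewrite oppositionE [X in X + _]big_pred0 ?add0r //.
  by apply: eq_big => S'; rewrite ?ffunE // capvC.
transitivity (N f1 S); last by rewrite Nf1 !ffunE.
rewrite oppositionE [X in _ + X]big_pred0 ?addr0 //.
by apply: eq_bigr => S' _; rewrite ffunE.
Qed.

Definition sqr_exponent i := (2 * 'C(i, 2) + e1 * (e2 - i) + e2 * (e1 - i))%N.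

(** A pair [(f1, f2)] as in [gamma_eigenvalue_pair] has [N N' f2 = z ^ 2 f2], and
    [f2 != 0] because [N] is injective.  Conversely an eigenvector [f2] of [N N']
    extends to the pair [(z^-1 N' f2, f2)]. *)
Lemma gamma_eigenvalue_sqr z : eigenvalue A z <->
  exists2 i, (i <= e2)%N & z ^+ 2 = (q ^ sqr_exponent i)%:R.
Proof.
have coefE i : (i <= e2)%N -> gram_coef K F e1 e2 i = (q ^ sqr_exponent i)%:R.
  by move=> lei; rewrite gram_coefE // (leq_trans lei).
rewrite gamma_eigenvalue_pair; split=> [[f1 [f2 [f12 Nf1 Nf2]]] | [i lei z2]].
  case: (eqVneq f2 0) f12 => [f20 | f20 _].
    rewrite orbF => /eqP[]; apply: (@opposition_inj K F _ e1 e2) => //.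
    by rewrite Nf1 f20 scaler0.
  have [|i lei z2] := gram_eigenvalue_only (erefl (e1 + e2)%N) f20 (mu := z ^+ 2).
    by rewrite comp_lfunE Nf2 linearZ /= Nf1 scalerA.
  by exists i; rewrite // z2 coefE.
have [f2 f20 gf2] := gram_eigenvalue_exists K F (erefl (e1 + e2)%N) le_e lei.
have z0 : z != 0.
  apply: contra_eq_neq z2 => ->; rewrite expr0n /= eq_sym pnatr_eq0 expn_eq0 negb_and.
  by rewrite -lt0n (ltnW (finNzRing_gt1 F)).
exists (z^-1 *: N' f2), f2; split; first by rewrite f20 orbT.
  by rewrite linearZ /= -[N _]comp_lfunE gf2 coefE // -z2 scalerA expr2 mulKf.
by rewrite scalerA divff // scale1r.
Qed.

End GammaSpectrum.

(** * The numbers lambda_j *)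

Section Lambda.

Variables (R : realType) (q e1 e2 : nat).
Hypothesis q_gt1 : (1 < q)%N.
Hypothesis le_e : (e2 <= e1)%N.
Local Notation lambda := (gamma_lambda R q e1 e2).

Lemma gamma_lambda_gt0 j : 0 < lambda j.
Proof. by rewrite powR_gt0 // ltr0n ltnW. Qed.

Lemma gamma_lambda_sqr j : (j <= e2)%N ->
  lambda j ^+ 2 = (q ^ sqr_exponent e1 e2 j)%:R.
Proof.
move=> lej; have lej1 := leq_trans lej le_e.
have q0 : q%:R != 0 :> R by rewrite pnatr_eq0 -lt0n ltnW.
rewrite expr2 -powRD; last by rewrite q0 implybT.
rewrite natrX -powR_mulrn ?ler0n //.
congr (_ `^ _); rewrite /gamma_exponent /sqr_exponent !natrD.
have -> : 'C(j, 2)%:R = j%:R * (j%:R - 1) / 2 :> R.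
  elim: j {lej lej1} => [|j IH]; first by rewrite bin0n !mul0r.
  by rewrite binS bin1 natrD IH -natr1; field.
by rewrite !natrM !natrB //; field.
Qed.

(** Consecutive exponents differ by [e1 + e2 - 2 j], which is positive for [j < e2]. *)
Lemma sqr_exponent_decr i j : (i < j)%N -> (j <= e2)%N ->
  (sqr_exponent e1 e2 j < sqr_exponent e1 e2 i)%N.
Proof.
elim: j => [//|j IH]; rewrite ltnS => leij lej.
have step : (sqr_exponent e1 e2 j.+1 < sqr_exponent e1 e2 j)%N.
  rewrite /sqr_exponent binS bin1 mulnDr.
  rewrite [(e2 - j)%N](_ : _ = (e2 - j.+1).+1); last by lia.
  rewrite [(e1 - j)%N](_ : _ = (e1 - j.+1).+1); last by lia.
  by rewrite !mulnS; lia.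
move: leij; rewrite leq_eqVlt => /orP[/eqP -> //|ltij].
exact: ltn_trans step (IH ltij (ltnW lej)).
Qed.

Lemma gamma_lambda_decr i j : (i < j)%N -> (j <= e2)%N -> lambda j < lambda i.
Proof.
move=> ltij lej; have lei := leq_trans (ltnW ltij) lej.
rewrite -(@ltr_pXn2r _ 2) ?nnegrE ?ltW ?gamma_lambda_gt0 //.
by rewrite !gamma_lambda_sqr // ltr_nat ltn_exp2l // sqr_exponent_decr.
Qed.

Lemma mem_gamma_eigenvalues x : x \in gamma_eigenvalues R q e1 e2 <->
  exists2 j, (j <= e2)%N & x = lambda j \/ x = - lambda j.
Proof.
rewrite mem_cat; split=> [/orP[] /mapP[j]|[j lej xE]].
- by rewrite mem_iota /= => lej ->; exists j; [|left].
- by rewrite mem_rev mem_iota /= => lej ->; exists j; [|right].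
by apply/orP; case: xE => ->; [left | right];
   apply: map_f; rewrite ?mem_rev mem_iota.
Qed.

Lemma gamma_eigenvalues_sorted : sorted >%R (gamma_eigenvalues R q e1 e2).
Proof.
have gt_trans : transitive (>%R : rel R) by move=> y x z xy yz; apply: lt_trans yz xy.
rewrite sorted_pairwise // pairwise_cat; apply/and3P; split.
- apply/allrelP => _ _ /mapP[i _ ->] /mapP[j _ ->] /=.
  by rewrite (lt_trans _ (gamma_lambda_gt0 i)) // oppr_lt0 gamma_lambda_gt0.
- rewrite -sorted_pairwise //.
  apply: (homo_sorted_in (P := mem (iota 0 e2.+1)) (e := ltn)).
  + by move=> i j _; rewrite mem_iota => lej ltij; apply: gamma_lambda_decr.
  + by apply/allP => i.
  exact: iota_ltn_sorted.
rewrite -sorted_pairwise // map_rev rev_sorted.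
apply: (homo_sorted_in (P := mem (iota 0 e2.+1)) (e := ltn)).
+ move=> i j _; rewrite mem_iota => lej ltij /=.
  by rewrite ltrN2; apply: gamma_lambda_decr.
+ by apply/allP => i.
exact: iota_ltn_sorted.
Qed.

End Lambda.

Theorem proposition1p2 (R : realType) (F : finFieldType) (q e1 e2 : nat)
    (hq : #|F| = q) (he2 : (1 <= e2)%N) (he12 : (e2 <= e1)%N) :
  sorted >%R (gamma_eigenvalues R q e1 e2) /\
  (forall z : R[i],
    eigenvalue (adjacency_matrix R[i] (@gamma_adj F e1 e2)) z <->
    exists2 x : R, x \in gamma_eigenvalues R q e1 e2 & z = x%:C%C).
Proof.
have q_gt1 : (1 < q)%N by rewrite -hq finNzRing_gt1.
split=> [|z]; first exact: gamma_eigenvalues_sorted.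
have sqrE j : (j <= e2)%N ->
    (#|F| ^ sqr_exponent e1 e2 j)%:R = (gamma_lambda R q e1 e2 j)%:C%C ^+ 2.
  by move=> lej; rewrite hq -rmorphXn /= gamma_lambda_sqr // rmorph_nat.
rewrite gamma_eigenvalue_sqr //; split=> [[j lej] | [x x_in ->]].
  rewrite sqrE // => /eqP; rewrite eqf_sqr => /orP[] /eqP ->.
    exists (gamma_lambda R q e1 e2 j) => //.
    by apply/mem_gamma_eigenvalues; exists j; [|left].
  exists (- gamma_lambda R q e1 e2 j); last by rewrite rmorphN.
  by apply/mem_gamma_eigenvalues; exists j; [|right].
case/mem_gamma_eigenvalues: x_in => j lej xE.
by exists j; rewrite // sqrE //; case: xE => ->; rewrite ?rmorphN ?sqrrN.
Qed.
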